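(* Let $(A,\mathcal L,[\cdot,\cdot]_{\mathcal L},\alpha)$ be a Lie-Rinehart algebra and $(\mathfrak g,[\cdot,\cdot]_{\mathfrak g})$ a $\mathbb K$-Lie algebra. Then any crossed homomorphism $H:\mathcal L\to\mathfrak g\otimes_{\mathbb K}A$ (with respect to the action of $\mathcal L$ on $\mathfrak g\otimes_{\mathbb K}A$ given by $\alpha(x)(g\otimes a)=g\otimes\alpha(x)(a)$) induces a left module category structure on the category $\mathsf{WRep}_{\mathbb K}(\mathcal L)$ of weak representations of $\mathcal L$ over the monoidal category $\mathsf{Rep}_{\mathbb K}(\mathfrak g)$ of representations of $\mathfrak g$. More precisely, the left module structure is given by: (1) the bifunctor $F_H:\mathsf{Rep}_{\mathbb K}(\mathfrak g)\times\mathsf{WRep}_{\mathbb K}(\mathcal L)\to\mathsf{WRep}_{\mathbb K}(\mathcal L)$ defined on objects by $F_H((V;\theta),(M;\rho))=(V\otimes_{\mathbb K}M;(\rho\boxplus\theta)\circ\iota_H)$ and on morphisms by $F_H(\psi,\phi)=\psi\otimes\phi:V\otimes M\to V'\otimes M'$, for a homomorphism $\psi:V\to V'$ of representations of $\mathfrak g$ and a homomorphism $\phi:M\to M'$ of weak representations of $\mathcal L$; (2) the natural isomorphism $a_{(V_1;\theta_1),(V_2;\theta_2),(M;\rho)}:F_H((V_1;\theta_1)\otimes(V_2;\theta_2),(M;\rho))\to F_H((V_1;\theta_1),F_H((V_2;\theta_2),(M;\rho)))$ defined by $(v_1\otimes v_2)\otimes m\mapsto v_1\otimes(v_2\otimes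 m)$; (3) the natural isomorphism $l_{(M;\rho)}:F_H((\mathbb K;0),(M;\rho))\to(M;\rho)$ defined by $k\otimes m\mapsto km$.
   Context: All vector spaces are over an algebraically closed field $\mathbb K$ of characteristic $0$; $A$ is a commutative associative $\mathbb K$-algebra and $\mathrm{Der}_{\mathbb K}(A)$ is its Lie algebra of $\mathbb K$-linear derivations. A Lie-Rinehart algebra $(A,\mathcal L,[\cdot,\cdot]_{\mathcal L},\alpha)$ is a $\mathbb K$-Lie algebra $\mathcal L$ with an $A$-module structure and a map $\alpha:\mathcal L\to\mathrm{Der}_{\mathbb K}(A)$ which is both a $\mathbb K$-Lie algebra homomorphism and an $A$-module homomorphism, such that $[x,ay]_{\mathcal L}=a[x,y]_{\mathcal L}+\alpha(x)(a)y$ for $x,y\in\mathcal L$, $a\in A$. A weak representation $(M;\rho)$ of $\mathcal L$ is an $A$-module $M$ with a $\mathbb K$-Lie algebra homomorphism $\rho:\mathcal L\to\mathfrak{gl}_{\mathbb K}(M)$ such that $\rho(x)(am)=a\rho(x)(m)+\alpha(x)(a)m$ for $x\in\mathcal L,a\in A,m\in M$. A homomorphism of weak representations $(M;\rho)\to(M';\rho')$ is an $A$-module homomorphism $\phi$ with $\phi\circ\rho(x)=\rho'(x)\circ\phi$ for all $x\in\mathcal L$. These form the category $\mathsf{WRep}_{\mathbb K}(\mathcal L)$. The space $\mathfrak g\otimes_{\mathbb K}A$ is a Lie $A$-algebra with $[g\otimes a,h\otimes b]=[g,h]_{\mathfrak g}\otimes ab$ and $a(g\otimes b)=g\otimes ab$.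 A crossed homomorphism $H:\mathcal L\to\mathfrak g\otimes_{\mathbb K}A$ is a $\mathbb K$-linear map with $H[x,y]_{\mathcal L}=\alpha(x)(Hy)-\alpha(y)(Hx)+[Hx,Hy]$ for all $x,y\in\mathcal L$. The semidirect product $\mathcal L\ltimes_\alpha(\mathfrak g\otimes_{\mathbb K}A)$ is $\mathcal L\oplus(\mathfrak g\otimes_{\mathbb K}A)$ with bracket $[(x,u),(y,v)]_\alpha=([x,y]_{\mathcal L},\alpha(x)v-\alpha(y)u+[u,v])$, and $\iota_H:\mathcal L\to\mathcal L\ltimes_\alpha(\mathfrak g\otimes_{\mathbb K}A)$ is $\iota_H(x)=(x,Hx)$. For $(V;\theta)\in\mathsf{Rep}_{\mathbb K}(\mathfrak g)$ and $(M;\rho)\in\mathsf{WRep}_{\mathbb K}(\mathcal L)$, the space $V\otimes_{\mathbb K}M$ has the $A$-module structure $a(v\otimes m)=v\otimes am$, and $\rho\boxplus\theta:\mathcal L\ltimes_\alpha(\mathfrak g\otimes_{\mathbb K}A)\to\mathfrak{gl}_{\mathbb K}(V\otimes_{\mathbb K}M)$ is the linear map $(\rho\boxplus\theta)(x,g\otimes a)(v\otimes m)=v\otimes\rho(x)m+\theta(g)v\otimes am$. $\mathsf{Rep}_{\mathbb K}(\mathfrak g)$ is the monoidal category of representations of $\mathfrak g$ with the usual tensor product $(V_1\otimes V_2;\theta_1\otimes\mathrm{Id}+\mathrm{Id}\otimes\theta_2)$, unit $(\mathbb K;0)$ and the usual associativity and unit isomorphisms. A left module category over a monoidal category $(\mathcal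 C,\otimes,a,\mathbf 1,l,r)$ is a category $\mathcal M$ with a bifunctor $\otimes^{\mathcal M}:\mathcal C\times\mathcal M\to\mathcal M$, a natural isomorphism $a^{\mathcal M}_{X,Y,M}:(X\otimes Y)\otimes^{\mathcal M}M\to X\otimes^{\mathcal M}(Y\otimes^{\mathcal M}M)$ and a natural isomorphism $l^{\mathcal M}_M:\mathbf 1\otimes^{\mathcal M}M\to M$ such that for all $X,Y,Z\in\mathcal C$, $M\in\mathcal M$: (pentagon) $a^{\mathcal M}_{X,Y,Z\otimes^{\mathcal M}M}\circ a^{\mathcal M}_{X\otimes Y,Z,M}=(\mathrm{Id}_X\otimes^{\mathcal M}a^{\mathcal M}_{Y,Z,M})\circ a^{\mathcal M}_{X,Y\otimes Z,M}\circ(a_{X,Y,Z}\otimes^{\mathcal M}\mathrm{Id}_M)$; (triangle) $(\mathrm{Id}_X\otimes^{\mathcal M}l^{\mathcal M}_M)\circ a^{\mathcal M}_{X,\mathbf 1,M}=r_X\otimes^{\mathcal M}\mathrm{Id}_M$. *)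

(* Defs.v *)
From HB Require Import structures.
From mathcomp Require Import all_boot all_algebra.
From mathcomp Require Import generic_quotient ring_quotient.
From mathcomp Require Import boolp.
From mathcomp.multinomials Require Import freeg.

Set Implicit Arguments.
Unset Strict Implicit.
Unset Printing Implicit Defensive.

Import GRing.Theory.
Local Open Scope ring_scope.
Local Open Scope quotient_scope.

Definition is_bilinear (K : fieldType) (V W U : lmodType K) (f : V -> W -> U) :
  Prop := (forall w, linear (f ^~ w)) /\ (forall v, linear (f v)).

(* The tensor product over [K]: the free [K]-module on [V * W] modulo the
   submodule spanned by the bilinearity relations. *)
Section Tensor.
Variables (K : fieldType) (V W : lmodType K).

Local Notation free := {freeg (V * W)%type / K}.

Inductive tens_rel : free -> Prop :=
| tens_rell (k : K) (v v' : V) (w : W) :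
    tens_rel (<< (k *: v + v', w) >> - (k *: << (v, w) >> + << (v', w) >>))
| tens_relr (k : K) (v : V) (w w' : W) :
    tens_rel (<< (v, k *: w + w') >> - (k *: << (v, w) >> + << (v, w') >>)).

Inductive tens_span : free -> Prop :=
| tens_span0 : tens_span 0
| tens_spanD (k : K) (x y : free) :
    tens_rel x -> tens_span y -> tens_span (k *: x + y).

Definition tens_ker : {pred free} := fun x => `[< tens_span x >].

Lemma tens_spanP x : reflect (tens_span x) (x \in tens_ker).
Proof. exact: asboolP. Qed.

Lemma tens_kerZ k x : x \in tens_ker -> k *: x \in tens_ker.
Proof.
move=> /tens_spanP xs; apply/tens_spanP; elim: xs => [|c y z yr _ IH].
  by rewrite scaler0; exact: tens_span0.
by rewrite scalerDr scalerA; exact: tens_spanD.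
Qed.

Lemma tens_kerD x y : x \in tens_ker -> y \in tens_ker -> x + y \in tens_ker.
Proof.
move=> /tens_spanP xs /tens_spanP ys; apply/tens_spanP.
elim: xs => [|c u z ur _ IH]; first by rewrite add0r.
by rewrite -addrA; exact: tens_spanD.
Qed.

Lemma tens_ker_zmod : zmod_closed tens_ker.
Proof.
split=> [|x y xs ys]; first by apply/tens_spanP; exact: tens_span0.
by rewrite tens_kerD // -scaleN1r tens_kerZ.
Qed.

HB.instance Definition _ := GRing.isZmodClosed.Build free tens_ker tens_ker_zmod.

Definition tens : Type := Quotient.quot tens_ker.

HB.instance Definition _ := GRing.Zmodule.on tens.

Definition tpi (x : free) : tens := \pi_(Quotient.quot tens_ker) x.
Definition trepr (t : tens) : free := repr (t : Quotient.quot tens_ker).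

Definition tpure (v : V) (w : W) : tens := tpi << (v, w) >>.

Lemma treprK t : tpi (trepr t) = t.
Proof. exact: reprK. Qed.

Lemma tpiP x y : tpi x = tpi y <-> tens_span (x - y).
Proof.
split=> [/eqP e|/tens_spanP e]; last by apply/eqP; rewrite -Quotient.idealrBE.
by apply/tens_spanP; rewrite Quotient.idealrBE.
Qed.

Lemma tpiD x y : tpi (x + y) = tpi x + tpi y.
Proof. exact: raddfD. Qed.

Definition tens_scale (k : K) (t : tens) : tens := tpi (k *: trepr t).

Lemma tpiZ k x : tens_scale k (tpi x) = tpi (k *: x).
Proof.
apply/tpiP; rewrite -scalerBr; apply/tens_spanP/tens_kerZ/tens_spanP/tpiP.
exact: treprK.
Qed.

Lemma tens_scaleA a b t :
  tens_scale a (tens_scale b t) = tens_scale (a * b) t.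
Proof. by rewrite -[t]treprK !tpiZ scalerA. Qed.
Lemma tens_scale1 : left_id 1 tens_scale.
Proof. by move=> t; rewrite -[t]treprK !tpiZ scale1r. Qed.
Lemma tens_scaleDr : right_distributive tens_scale +%R.
Proof.
by move=> a s t; rewrite -[s]treprK -[t]treprK -tpiD !tpiZ scalerDr tpiD.
Qed.
Lemma tens_scaleDl t : {morph tens_scale^~ t : a b / a + b}.
Proof. by move=> a b; rewrite -[t]treprK !tpiZ scalerDl tpiD. Qed.

HB.instance Definition _ := GRing.Zmodule_isLmodule.Build K tens
  tens_scaleA tens_scale1 tens_scaleDr tens_scaleDl.

Lemma tpi_linear : linear tpi.
Proof. by move=> k x y; rewrite tpiD -tpiZ. Qed.
HB.instance Definition _ := GRing.isLinear.Build K free tens *:%R tpi tpi_linear.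

Lemma tpure_bilinear : is_bilinear tpure.
Proof.
split=> [w k v v'|v k w w']; rewrite /tpure -linearP; apply/tpiP.
  by rewrite -[X in tens_span X]addr0 -[X in X + 0]scale1r;
    apply: tens_spanD; [exact: tens_rell|exact: tens_span0].
by rewrite -[X in tens_span X]addr0 -[X in X + 0]scale1r;
  apply: tens_spanD; [exact: tens_relr|exact: tens_span0].
Qed.

Lemma tens_ind (P : tens -> Prop) :
  P 0 -> (forall k v w t, P t -> P (k *: tpure v w + t)) -> forall t, P t.
Proof.
move=> P0 PD t; rewrite -[t]treprK -[trepr t]freeg_sumE.
elim: (dom _) => [|[v w] s IH]; first by rewrite big_nil linear0.
rewrite big_cons linearD /=; set c := coeff _ _.
have -> : << c *g (v, w) >> = c *: << (v, w) >> :> free.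
  by apply/eqP/freeg_eqP => x; rewrite coeffZ !coeffU mul1r.
by rewrite linearZ; exact: PD.
Qed.

End Tensor.

Notation "v ⊗ w" := (tpure v w) (at level 40, left associativity) : ring_scope.

(* [tens_lift f] is the linear map with [v ⊗ w |-> f v w]; it is meaningful
   only for bilinear [f] (see [tens_liftE]). *)
Section Lift.
Variables (K : fieldType) (V W U : lmodType K).

Definition tens_lift (f : V -> W -> U) (t : tens V W) : U :=
  fglift (fun p : V * W => f p.1 p.2) (trepr t).

Lemma fglift_linear (T : choiceType) (f : T -> U) :
  linear (fglift f : {freeg T / K} -> U).
Proof.
have fD : additive (fglift f) := lift_is_additive f.
have f0 : fglift f 0 = 0 by rewrite -[0 in LHS](subrr 0) fD subrr.
have fN x : fglift f (- x) = - fglift f x by rewrite -sub0r fD f0 sub0r.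
have fA x y : fglift f (x + y) = fglift f x + fglift f y.
  by rewrite -{1}[y]opprK fD fN opprK.
move=> k x y; rewrite fA; congr (_ + _).
rewrite -[x]freeg_sumE scaler_sumr.
elim: (dom x) => [|p s IH]; first by rewrite !big_nil f0 scaler0.
rewrite !big_cons !fA IH scalerDr; congr (_ + _).
set c := coeff p x.
have -> : k *: << c *g p >> = << k * c *g p >> :> {freeg T / K}.
  by apply/eqP/freeg_eqP => z; rewrite coeffZ !coeffU mulrA.
by rewrite !liftU scalerA.
Qed.

Variable f : V -> W -> U.
Hypothesis f_bil : is_bilinear f.

Let F := fglift (fun p : V * W => f p.1 p.2).
Let FP : linear F. Proof. exact: fglift_linear. Qed.
Let FU p : F << p >> = f p.1 p.2. Proof. by rewrite /F liftU scale1r. Qed.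
Let FD x y : F (x + y) = F x + F y.
Proof. by have := FP 1 x y; rewrite !scale1r. Qed.
Let F0 : F 0 = 0.
Proof. by apply: (addrI (F 0)); rewrite -FD !addr0. Qed.
Let FN x : F (- x) = - F x.
Proof. by have := FP (-1) x 0; rewrite !scaleN1r F0 !addr0. Qed.

Let F_ker x : tens_span x -> F x = 0.
Proof.
elim=> [|k y z yr _ IH]; first exact: F0.
rewrite FP IH addr0; suff -> : F y = 0 by rewrite scaler0.
by case: yr => [c v v' w|c v w w'];
  rewrite FD FN FP !FU /= ?(proj1 f_bil) ?(proj2 f_bil) subrr.
Qed.

Let F_tpi x : tens_lift f (tpi x) = F x.
Proof.
apply/eqP; rewrite -subr_eq0 -FN -FD F_ker //; apply/tpiP; exact: treprK.
Qed.

Lemma tens_liftE v w : tens_lift f (v ⊗ w) = f v w.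
Proof. by rewrite F_tpi FU. Qed.

Lemma tens_lift_linear : linear (tens_lift f).
Proof.
by move=> k x y; rewrite -[x]treprK -[y]treprK -linearP !F_tpi FP.
Qed.

End Lift.

Lemma tens_ext (K : fieldType) (V W U : lmodType K) (f g : tens V W -> U) :
  linear f -> linear g -> (forall v w, f (v ⊗ w) = g (v ⊗ w)) -> f =1 g.
Proof.
move=> fl gl fg; apply: tens_ind => [|k v w t IH].
  have z h : linear h -> h 0 = 0 :> U.
    by move=> hl; have := hl (-1) 0 0; rewrite scaler0 addr0 scaleN1r addNr.
  by rewrite !z.
by rewrite fl gl fg IH.
Qed.

Section TensMap.
Variables (K : fieldType) (V V' W W' : lmodType K).

Definition tens_map (f : V -> V') (g : W -> W') : tens V W -> tens V' W' :=
  tens_lift (fun v w => f v ⊗ g w).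

Variables (f : V -> V') (g : W -> W').
Hypotheses (fl : linear f) (gl : linear g).

Let bil : is_bilinear (fun v w => f v ⊗ g w).
Proof.
by split=> [w k v v'|v k w w']; rewrite ?fl ?gl;
  [exact: (proj1 (tpure_bilinear _ _))|exact: (proj2 (tpure_bilinear _ _))].
Qed.

Lemma tens_mapE v w : tens_map f g (v ⊗ w) = f v ⊗ g w.
Proof. by rewrite /tens_map tens_liftE. Qed.

Lemma tens_map_linear : linear (tens_map f g).
Proof. exact: tens_lift_linear. Qed.

End TensMap.

Lemma tens_lift_linr (K : fieldType) (V W U : lmodType K) k
    (f h : V -> W -> U) (t : tens V W) :
  tens_lift (fun v w => k *: f v w + h v w) t =
  k *: tens_lift f t + tens_lift h t.
Proof.
rewrite /tens_lift; move: (trepr t) => x; elim/quotW: x => x.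
by rewrite !piE /lift /prelift scaler_sumr -big_split;
  apply: eq_bigr => p _; rewrite scalerDr !scalerA mulrC.
Qed.

Section LinearFacts.
Variables (K : fieldType) (U V W : lmodType K).

Lemma linear_id : linear (@id V). Proof. by []. Qed.

Lemma linear_comp (f : V -> W) (h : U -> V) :
  linear f -> linear h -> linear (fun x => f (h x)).
Proof. by move=> fl hl k x y; rewrite hl fl. Qed.

Lemma linear_add (f h : V -> W) :
  linear f -> linear h -> linear (fun x => f x + h x).
Proof. by move=> fl hl k x y; rewrite fl hl scalerDr addrACA. Qed.

Lemma linear_addscale k (f h : V -> W) :
  linear f -> linear h -> linear (fun x => k *: f x + h x).
Proof.
move=> fl hl c x y; rewrite fl hl !scalerDr !scalerA [k * c]mulrC.
by rewrite addrACA.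
Qed.

Lemma linear_sub (f h : V -> W) :
  linear f -> linear h -> linear (fun x => f x - h x).
Proof. by move=> fl hl k x y; rewrite fl hl scalerBr opprD addrACA. Qed.

Lemma linear_purel (w : W) : linear (fun v : V => v ⊗ w).
Proof. exact: (proj1 (tpure_bilinear V W)). Qed.

Lemma linear_purer (v : V) : linear (fun w : W => v ⊗ w).
Proof. exact: (proj2 (tpure_bilinear V W)). Qed.

Lemma linearfD (f : V -> W) x y : linear f -> f (x + y) = f x + f y.
Proof. by move=> fl; have := fl 1 x y; rewrite !scale1r. Qed.

Lemma linearf0 (f : V -> W) : linear f -> f 0 = 0.
Proof. by move=> fl; apply: (addrI (f 0)); rewrite -linearfD // !addr0. Qed.

Lemma linearfZ (f : V -> W) k x : linear f -> f (k *: x) = k *: f x.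
Proof. by move=> fl; have := fl k x 0; rewrite linearf0 // !addr0. Qed.

Lemma linearfB (f : V -> W) x y : linear f -> f (x - y) = f x - f y.
Proof.
by move=> fl; rewrite -scaleN1r linearfD // linearfZ // scaleN1r.
Qed.

End LinearFacts.

Section TensAssoc.
Variables (K : fieldType) (U V W : lmodType K).

Definition tens_assoc : tens (tens U V) W -> tens U (tens V W) :=
  tens_lift (fun (t : tens U V) (w : W) =>
    tens_lift (fun (u : U) (v : V) => u ⊗ (v ⊗ w)) t).

Definition tens_assocV : tens U (tens V W) -> tens (tens U V) W :=
  tens_lift (fun (u : U) (t : tens V W) =>
    tens_lift (fun (v : V) (w : W) => u ⊗ v ⊗ w) t).

Let bil1 (w : W) : is_bilinear (fun (u : U) (v : V) => u ⊗ (v ⊗ w)).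
Proof.
split=> [v|u] k x y; first exact: linear_purel.
by rewrite linear_purel linear_purer.
Qed.

Let bil1V (u : U) :
  is_bilinear (fun (v : V) (w : W) => u ⊗ v ⊗ w).
Proof.
split=> [w|v] k x y; last exact: linear_purer.
by rewrite linear_purer linear_purel.
Qed.

Let bil2 : is_bilinear
  (fun (t : tens U V) (w : W) =>
     tens_lift (fun (u : U) (v : V) => u ⊗ (v ⊗ w)) t).
Proof.
split=> [w|t k w w']; first exact: (tens_lift_linear (bil1 w)).
rewrite -tens_lift_linr; congr tens_lift.
by apply/funext => u; apply/funext => v; rewrite !linear_purer.
Qed.

Let bil2V : is_bilinear
  (fun (u : U) (t : tens V W) =>
     tens_lift (fun (v : V) (w : W) => u ⊗ v ⊗ w) t).
Proof.
split=> [t k u u'|u]; last exact: (tens_lift_linear (bil1V u)).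
rewrite -tens_lift_linr; congr tens_lift.
by apply/funext => v; apply/funext => w; rewrite !linear_purel.
Qed.

Lemma tens_assocE (u : U) (v : V) (w : W) : tens_assoc (u ⊗ v ⊗ w) = u ⊗ (v ⊗ w).
Proof. by rewrite /tens_assoc (tens_liftE bil2) (tens_liftE (bil1 w)). Qed.

Lemma tens_assocVE (u : U) (v : V) (w : W) : tens_assocV (u ⊗ (v ⊗ w)) = u ⊗ v ⊗ w.
Proof. by rewrite /tens_assocV (tens_liftE bil2V) (tens_liftE (bil1V u)). Qed.

Lemma tens_assoc_linear : linear tens_assoc.
Proof. exact: tens_lift_linear bil2. Qed.

Lemma tens_assocV_linear : linear tens_assocV.
Proof. exact: tens_lift_linear bil2V. Qed.

Lemma tens_extl (X : lmodType K) (f h : tens (tens U V) W -> X) :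
  linear f -> linear h ->
  (forall (u : U) (v : V) (w : W), f (u ⊗ v ⊗ w) = h (u ⊗ v ⊗ w)) -> f =1 h.
Proof.
move=> fl hl fh; apply: tens_ext => // t w.
apply: (tens_ext (f := fun t => f (t ⊗ w)) (g := fun t => h (t ⊗ w))) => //;
  exact: (linear_comp _ (linear_purel w)).
Qed.

Lemma tens_extr (X : lmodType K) (f h : tens U (tens V W) -> X) :
  linear f -> linear h ->
  (forall (u : U) (v : V) (w : W), f (u ⊗ (v ⊗ w)) = h (u ⊗ (v ⊗ w))) -> f =1 h.
Proof.
move=> fl hl fh; apply: tens_ext => // u t.
apply: (tens_ext (f := fun t => f (u ⊗ t)) (g := fun t => h (u ⊗ t))) => //;
  exact: (linear_comp _ (linear_purer u)).
Qed.

End TensAssoc.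

Section TensUnit.
Variables (K : fieldType) (V : lmodType K).

Definition tens_unitl : tens K^o V -> V := tens_lift (fun (k : K^o) v => k *: v).
Definition tens_unitr : tens V K^o -> V := tens_lift (fun v (k : K^o) => k *: v).

Let bill : is_bilinear (fun (k : K^o) (v : V) => k *: v).
Proof.
split=> [v|k] c x y /=; first by rewrite scalerDl scalerA.
by rewrite scalerDr !scalerA mulrC.
Qed.

Let bilr : is_bilinear (fun (v : V) (k : K^o) => k *: v).
Proof. by split; [exact: (proj2 bill)|exact: (proj1 bill)]. Qed.

Lemma tens_unitlE k v : tens_unitl (k ⊗ v) = k *: v.
Proof. exact: (tens_liftE bill). Qed.

Lemma tens_unitrE v k : tens_unitr (v ⊗ k) = k *: v.
Proof. exact: (tens_liftE bilr). Qed.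

Lemma tens_unitl_linear : linear tens_unitl.
Proof. exact: tens_lift_linear bill. Qed.

Lemma tens_unitr_linear : linear tens_unitr.
Proof. exact: tens_lift_linear bilr. Qed.

End TensUnit.

Record category := Category {
  obj :> Type;
  mor : obj -> obj -> Type;
  idm : forall X, mor X X;
  mcomp : forall X Y Z, mor Y Z -> mor X Y -> mor X Z;
  comp_idl : forall X Y (f : mor X Y), mcomp (idm Y) f = f;
  comp_idr : forall X Y (f : mor X Y), mcomp f (idm X) = f;
  compA : forall X Y Z T (h : mor Z T) (g : mor Y Z) (f : mor X Y),
    mcomp h (mcomp g f) = mcomp (mcomp h g) f }.

Arguments idm {c} X.
Arguments mcomp {c X Y Z} _ _.
Notation "g ∘ f" := (mcomp g f) (at level 40, left associativity).

Definition is_iso (C : category) (X Y : C) (f : mor X Y) : Prop :=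
  exists g : mor Y X, g ∘ f = idm X /\ f ∘ g = idm Y.

Definition is_bifunctor (C D E : category) (F0 : C -> D -> E)
    (F1 : forall X X' Y Y', mor X X' -> mor Y Y' -> mor (F0 X Y) (F0 X' Y'))
    : Prop :=
  (forall X Y, F1 _ _ _ _ (idm X) (idm Y) = idm (F0 X Y)) /\
  (forall X X' X'' Y Y' Y'' (f' : mor X' X'') (f : mor X X')
      (g' : mor Y' Y'') (g : mor Y Y'),
    F1 _ _ _ _ (f' ∘ f) (g' ∘ g) = F1 _ _ _ _ f' g' ∘ F1 _ _ _ _ f g).

Record monoidal_category := MonoidalCategory {
  mon_cat :> category;
  ten : mon_cat -> mon_cat -> mon_cat;
  ten_hom : forall X X' Y Y',
    mor X X' -> mor Y Y' -> mor (ten X Y) (ten X' Y');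
  ten_bifunctor : is_bifunctor ten_hom;
  unit_obj : mon_cat;
  assoc : forall X Y Z, mor (ten (ten X Y) Z) (ten X (ten Y Z));
  unitl : forall X, mor (ten unit_obj X) X;
  unitr : forall X, mor (ten X unit_obj) X;
  assoc_iso : forall X Y Z, is_iso (assoc X Y Z);
  unitl_iso : forall X, is_iso (unitl X);
  unitr_iso : forall X, is_iso (unitr X);
  assoc_natural : forall X X' Y Y' Z Z'
      (f : mor X X') (g : mor Y Y') (h : mor Z Z'),
    assoc X' Y' Z' ∘ ten_hom (ten_hom f g) h =
    ten_hom f (ten_hom g h) ∘ assoc X Y Z;
  unitl_natural : forall X X' (f : mor X X'),
    unitl X' ∘ ten_hom (idm unit_obj) f = f ∘ unitl X;
  unitr_natural : forall X X' (f : mor X X'),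
    unitr X' ∘ ten_hom f (idm unit_obj) = f ∘ unitr X;
  mon_pentagon : forall X Y Z T,
    assoc X Y (ten Z T) ∘ assoc (ten X Y) Z T =
    ten_hom (idm X) (assoc Y Z T) ∘ assoc X (ten Y Z) T
      ∘ ten_hom (assoc X Y Z) (idm T);
  mon_triangle : forall X Y,
    ten_hom (idm X) (unitl Y) ∘ assoc X unit_obj Y =
    ten_hom (unitr X) (idm Y) }.

Record is_left_module_category (C : monoidal_category) (M : category)
    (act : C -> M -> M)
    (act_hom : forall X X' N N',
      mor X X' -> mor N N' -> mor (act X N) (act X' N'))
    (a : forall X Y N, mor (act (ten X Y) N) (act X (act Y N)))
    (l : forall N, mor (act (unit_obj C) N) N) : Prop := IsLeftModuleCategory {
  act_bifunctor : is_bifunctor act_hom;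
  act_assoc_iso : forall X Y N, is_iso (a X Y N);
  act_assoc_natural : forall X X' Y Y' N N'
      (f : mor X X') (g : mor Y Y') (h : mor N N'),
    a X' Y' N' ∘ act_hom _ _ _ _ (ten_hom f g) h =
    act_hom _ _ _ _ f (act_hom _ _ _ _ g h) ∘ a X Y N;
  act_unit_iso : forall N, is_iso (l N);
  act_unit_natural : forall N N' (f : mor N N'),
    l N' ∘ act_hom _ _ _ _ (idm (unit_obj C)) f = f ∘ l N;
  act_pentagon : forall X Y Z N,
    a X Y (act Z N) ∘ a (ten X Y) Z N =
    act_hom _ _ _ _ (idm X) (a Y Z N) ∘ a X (ten Y Z) N
      ∘ act_hom _ _ _ _ (assoc X Y Z) (idm N);
  act_triangle : forall X N,
    act_hom _ _ _ _ (idm X) (l N) ∘ a X (unit_obj C) N =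
    act_hom _ _ _ _ (unitr X) (idm N) }.

Record is_lie_bracket (K : fieldType) (g : lmodType K) (br : g -> g -> g)
    : Prop := IsLieBracket {
  br_bilinear : is_bilinear br;
  brxx : forall x, br x x = 0;
  br_jacobi : forall x y z,
    br x (br y z) + br y (br z x) + br z (br x y) = 0 }.

Record lieAlgebra (K : fieldType) := LieAlgebra {
  lie_mod :> lmodType K;
  lie_br : lie_mod -> lie_mod -> lie_mod;
  lie_brP : is_lie_bracket lie_br }.

Section Rep.
Variables (K : fieldType) (g : lieAlgebra K).

Record is_rep (V : lmodType K) (theta : g -> V -> V) : Prop := IsRep {
  rep_bilinear : is_bilinear theta;
  rep_br : forall x y v,
    theta (lie_br x y) v = theta x (theta y v) - theta y (theta x v) }.

Record rep := Rep {
  rep_mod :> lmodType K;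
  rep_act : g -> rep_mod -> rep_mod;
  rep_actP : is_rep rep_act }.

Definition is_rep_hom (V W : rep) (f : V -> W) : Prop :=
  linear f /\ forall x v, f (rep_act x v) = rep_act x (f v).

Record rep_hom (V W : rep) := RepHom {
  rep_fun :> V -> W;
  rep_funP : is_rep_hom rep_fun }.

Lemma rep_hom_ext (V W : rep) (f h : rep_hom V W) : f =1 h -> f = h.
Proof.
case: f h => [f fP] [h hP] /= /funext e; case: _ / e hP => hP.
by congr RepHom; exact: Prop_irrelevance.
Qed.

Lemma rep_id_subproof (V : rep) : is_rep_hom (@id V).
Proof. by []. Qed.
Definition rep_id V := RepHom (rep_id_subproof V).

Lemma rep_comp_subproof (U V W : rep) (f : rep_hom V W) (h : rep_hom U V) :
  is_rep_hom (f \o h).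
Proof.
case: f h => [f [fl fx]] [h [hl hx]]; split=> [k x y|x v] /=.
  by rewrite hl fl.
by rewrite hx fx.
Qed.
Definition rep_comp U V W f h := RepHom (@rep_comp_subproof U V W f h).

Definition Rep_cat : category.
Proof.
apply: (@Category rep rep_hom rep_id rep_comp).
- by move=> V W f; apply: rep_hom_ext.
- by move=> V W f; apply: rep_hom_ext.
- by move=> U V W T f h k; apply: rep_hom_ext.
Defined.

Let commutator_addK (Z : zmodType) (a b c d p q : Z) :
  a - b + (c - d) = a + p + (q + c) - (b + q + (p + d)).
Proof.
rewrite [q + c]addrC [a + p + _]addrACA [p + d]addrC [b + q + _]addrACA.
by rewrite opprD [RHS]addrACA [q + p]addrC subrr addr0 opprD [RHS]addrACA.
Qed.

Definition rep_ten_act (V W : rep) (x : g) (t : tens V W) : tens V W :=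
  tens_map (rep_act x) id t + tens_map id (rep_act x) t.

Lemma rep_act_linear (V : rep) x : linear (@rep_act V x).
Proof. by case: V x => V th [[thl thr] thb] x /=; exact: thr. Qed.

Lemma rep_act_linearl (V : rep) v : linear (fun x => @rep_act V x v).
Proof. by case: V v => V th [[thl thr] thb] v /=; exact: thl. Qed.

Lemma rep_act_br (V : rep) x y (v : V) :
  rep_act (lie_br x y) v = rep_act x (rep_act y v) - rep_act y (rep_act x v).
Proof. by case: V v => V th [thl thb] v /=; exact: thb. Qed.

Lemma rep_ten_actE (V W : rep) x (v : V) (w : W) :
  rep_ten_act x (v ⊗ w) = rep_act x v ⊗ w + v ⊗ rep_act x w.
Proof.
by rewrite /rep_ten_act !tens_mapE //; exact: rep_act_linear.
Qed.

Lemma rep_ten_act_linear (V W : rep) x : linear (@rep_ten_act V W x).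
Proof.
by apply: linear_add; apply: tens_map_linear => //; exact: rep_act_linear.
Qed.

Lemma rep_ten_subproof (V W : rep) : is_rep (@rep_ten_act V W).
Proof.
have L := @rep_ten_act_linear V W.
split=> [|x y].
  split=> [t k x y|x]; last exact: L.
  move: t; apply: tens_ext; [exact: L|exact: linear_addscale|move=> v w].
  rewrite !rep_ten_actE !rep_act_linearl linear_purel linear_purer.
  by rewrite scalerDr addrACA.
apply: tens_ext; first exact: L.
  by apply: linear_sub; apply: linear_comp; exact: L.
move=> v w; rewrite !rep_ten_actE !(linearfD _ _ (L _)) !rep_ten_actE.
rewrite !rep_act_br.
rewrite (linearfB _ _ (linear_purel _)) (linearfB _ _ (linear_purer _)).
set a := _ x (_ y v) ⊗ w; set b := _ y (_ x v) ⊗ w.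
set c := v ⊗ _; set d := v ⊗ _; set p := _ ⊗ _; set q := _ ⊗ _.
exact: commutator_addK.
Qed.

Definition rep_ten (V W : rep) : rep := Rep (rep_ten_subproof V W).

Lemma rep_unit_subproof : is_rep (fun (_ : g) (_ : K^o) => 0 : K^o).
Proof.
split=> [|x y v]; last by rewrite subr0.
by split=> [w|v] k x y; rewrite scaler0 addr0.
Qed.

Definition rep_unit : rep := Rep rep_unit_subproof.

Lemma rep_fun_linear (V W : rep) (f : rep_hom V W) : linear f.
Proof. by case: f => f []. Qed.

Lemma rep_fun_act (V W : rep) (f : rep_hom V W) x v :
  f (rep_act x v) = rep_act x (f v).
Proof. by case: f => f []. Qed.

Lemma linear_rep_actr (V W : rep) (f : V -> W) x :
  linear f -> linear (fun v => f (rep_act x v)).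
Proof. by move=> fl; exact: linear_comp fl (rep_act_linear _). Qed.

Lemma linear_rep_actl (V W : rep) (f : V -> W) x :
  linear f -> linear (fun v => rep_act x (f v)).
Proof. by move=> fl; exact: linear_comp (rep_act_linear _) fl. Qed.

Lemma rep_ten_hom_subproof (V V' W W' : rep)
    (f : rep_hom V V') (h : rep_hom W W') :
  @is_rep_hom (rep_ten V W) (rep_ten V' W') (tens_map f h).
Proof.
have fl := rep_fun_linear f; have hl := rep_fun_linear h.
have L := tens_map_linear fl hl.
split=> // x; apply: tens_ext.
- exact: (@linear_rep_actr (rep_ten V W) (rep_ten V' W') _ x L).
- exact: (@linear_rep_actl (rep_ten V W) (rep_ten V' W') _ x L).
move=> v w /=; rewrite rep_ten_actE linearfD // !tens_mapE //.
by rewrite rep_ten_actE !rep_fun_act.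
Qed.

Definition rep_ten_hom (V V' W W' : rep)
    (f : rep_hom V V') (h : rep_hom W W') :
  rep_hom (rep_ten V W) (rep_ten V' W') := RepHom (rep_ten_hom_subproof f h).

Lemma rep_assoc_subproof (U V W : rep) :
  @is_rep_hom (rep_ten (rep_ten U V) W) (rep_ten U (rep_ten V W))
    (@tens_assoc K U V W).
Proof.
have L := @tens_assoc_linear K U V W.
split=> // x; apply: tens_extl.
- exact: (@linear_rep_actr (rep_ten (rep_ten U V) W) (rep_ten U (rep_ten V W)) _ x L).
- exact: (@linear_rep_actl (rep_ten (rep_ten U V) W) (rep_ten U (rep_ten V W)) _ x L).
move=> u v w /=; rewrite tens_assocE.
rewrite (@rep_ten_actE (rep_ten U V)) (@rep_ten_actE U (rep_ten V W)) /=.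
rewrite !rep_ten_actE (linearfD _ _ (linear_purel _)).
rewrite (linearfD _ _ (linear_purer _)) !(linearfD _ _ L) !tens_assocE.
by rewrite addrA.
Qed.

Definition rep_assoc U V W := RepHom (rep_assoc_subproof U V W).

Lemma rep_assocV_subproof (U V W : rep) :
  @is_rep_hom (rep_ten U (rep_ten V W)) (rep_ten (rep_ten U V) W)
    (@tens_assocV K U V W).
Proof.
have L := @tens_assocV_linear K U V W.
split=> // x; apply: tens_extr.
- exact: (@linear_rep_actr (rep_ten U (rep_ten V W)) (rep_ten (rep_ten U V) W) _ x L).
- exact: (@linear_rep_actl (rep_ten U (rep_ten V W)) (rep_ten (rep_ten U V) W) _ x L).
move=> u v w /=; rewrite tens_assocVE.
rewrite (@rep_ten_actE (rep_ten U V)) (@rep_ten_actE U (rep_ten V W)) /=.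
rewrite !rep_ten_actE (linearfD _ _ (linear_purel _)).
rewrite (linearfD _ _ (linear_purer _)) !(linearfD _ _ L) !tens_assocVE.
by rewrite addrA.
Qed.

Definition rep_assocV U V W := RepHom (rep_assocV_subproof U V W).

Lemma rep_unitl_subproof (V : rep) :
  @is_rep_hom (rep_ten rep_unit V) V (@tens_unitl K V).
Proof.
have L := @tens_unitl_linear K V.
split=> // x; apply: tens_ext.
- exact: (@linear_rep_actr (rep_ten rep_unit V) V _ x L).
- exact: (@linear_rep_actl (rep_ten rep_unit V) V _ x L).
move=> k v /=; rewrite (@rep_ten_actE rep_unit) linearfD // !tens_unitlE.
by rewrite scale0r add0r (linearfZ _ _ (rep_act_linear _)).
Qed.

Definition rep_unitl V := RepHom (rep_unitl_subproof V).

Lemma rep_unitr_subproof (V : rep) :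
  @is_rep_hom (rep_ten V rep_unit) V (@tens_unitr K V).
Proof.
have L := @tens_unitr_linear K V.
split=> // x; apply: tens_ext.
- exact: (@linear_rep_actr (rep_ten V rep_unit) V _ x L).
- exact: (@linear_rep_actl (rep_ten V rep_unit) V _ x L).
move=> v k /=; rewrite (@rep_ten_actE V rep_unit) linearfD // !tens_unitrE.
by rewrite scale0r addr0 (linearfZ _ _ (rep_act_linear _)).
Qed.

Definition rep_unitr V := RepHom (rep_unitr_subproof V).

Lemma rep_unitlV_subproof (V : rep) :
  @is_rep_hom V (rep_ten rep_unit V) (fun v => (1 : K^o) ⊗ v).
Proof.
split=> [|x v /=]; first exact: linear_purer.
by rewrite (@rep_ten_actE rep_unit) /= (linearf0 (linear_purel _)) add0r.
Qed.

Lemma rep_unitrV_subproof (V : rep) :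
  @is_rep_hom V (rep_ten V rep_unit) (fun v => v ⊗ (1 : K^o)).
Proof.
split=> [|x v /=]; first exact: linear_purel.
by rewrite (@rep_ten_actE V rep_unit) /= (linearf0 (linear_purer _)) addr0.
Qed.

Lemma rep_ten_ext (V W U : rep) (f h : rep_hom (rep_ten V W) U) :
  (forall v w, f (v ⊗ w) = h (v ⊗ w)) -> f = h.
Proof.
move=> fh; apply: rep_hom_ext.
exact: (tens_ext (@rep_fun_linear (rep_ten V W) U f)
                 (@rep_fun_linear (rep_ten V W) U h) fh).
Qed.

Lemma rep_ten_extl (V W U X : rep) (f h : rep_hom (rep_ten (rep_ten V W) U) X) :
  (forall (v : V) (w : W) (u : U), f (v ⊗ w ⊗ u) = h (v ⊗ w ⊗ u)) -> f = h.
Proof.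
move=> fh; apply: rep_hom_ext.
exact: (tens_extl (@rep_fun_linear (rep_ten (rep_ten V W) U) X f)
                  (@rep_fun_linear (rep_ten (rep_ten V W) U) X h) fh).
Qed.

Lemma rep_ten_extr (V W U X : rep) (f h : rep_hom (rep_ten V (rep_ten W U)) X) :
  (forall (v : V) (w : W) (u : U), f (v ⊗ (w ⊗ u)) = h (v ⊗ (w ⊗ u))) -> f = h.
Proof.
move=> fh; apply: rep_hom_ext.
exact: (tens_extr (@rep_fun_linear (rep_ten V (rep_ten W U)) X f)
                  (@rep_fun_linear (rep_ten V (rep_ten W U)) X h) fh).
Qed.

Lemma rep_ten_extll (V W U X Y : rep)
    (f h : rep_hom (rep_ten (rep_ten (rep_ten V W) U) X) Y) :
  (forall (v : V) (w : W) (u : U) (x : X),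
    f (v ⊗ w ⊗ u ⊗ x) = h (v ⊗ w ⊗ u ⊗ x)) -> f = h.
Proof.
move=> fh; apply: rep_ten_ext => t x; move: t.
have L (k : rep_hom (rep_ten (rep_ten (rep_ten V W) U) X) Y) :
    linear (fun t : tens (tens V W) U => k (t ⊗ x)).
  exact: (linear_comp
    (@rep_fun_linear (rep_ten (rep_ten (rep_ten V W) U) X) Y k) (linear_purel x)).
by apply: (tens_extl (L f) (L h)) => v w u; exact: fh.
Qed.

Lemma rep_ten_homE (V V' W W' : rep) (f : rep_hom V V') (h : rep_hom W W') v w :
  tens_map f h (v ⊗ w) = f v ⊗ h w.
Proof. by rewrite tens_mapE //; exact: rep_fun_linear. Qed.

Definition Rep_mon : monoidal_category.
Proof.
apply: (@MonoidalCategory Rep_cat rep_ten rep_ten_hom _ rep_unit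
          rep_assoc rep_unitl rep_unitr).
- split=> [V W|V V' V'' W W' W'' f' f h' h]; apply: rep_ten_ext => v w.
    by rewrite /= tens_mapE.
  rewrite /= !rep_ten_homE; exact: (rep_ten_homE (rep_comp f' f) (rep_comp h' h)).
- move=> U V W; exists (rep_assocV U V W); split.
    by apply: rep_ten_extl => u v w /=; rewrite tens_assocE tens_assocVE.
  by apply: rep_ten_extr => u v w /=; rewrite tens_assocVE tens_assocE.
- move=> V; exists (RepHom (rep_unitlV_subproof V)).
  split; last by apply: rep_hom_ext => v /=; rewrite tens_unitlE scale1r.
  apply: rep_ten_ext => k v /=; rewrite tens_unitlE.
  by rewrite (linearfZ _ _ (linear_purer _)) -(linearfZ _ _ (linear_purel _))
    /= [_ *: _]mulr1.
- move=> V; exists (RepHom (rep_unitrV_subproof V)).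
  split; last by apply: rep_hom_ext => v /=; rewrite tens_unitrE scale1r.
  apply: rep_ten_ext => v k /=; rewrite tens_unitrE.
  by rewrite (linearfZ _ _ (linear_purel _)) -(linearfZ _ _ (linear_purer _))
    /= [_ *: _]mulr1.
- move=> U U' V V' W W' f h k; apply: rep_ten_extl => u v w /=.
  rewrite tens_assocE (rep_ten_homE (rep_ten_hom f h) k) /= rep_ten_homE.
  by rewrite tens_assocE (rep_ten_homE f (rep_ten_hom h k)) /= rep_ten_homE.
- move=> V V' f; apply: rep_ten_ext => k v /=.
  by rewrite (rep_ten_homE (rep_id rep_unit) f) !tens_unitlE (linearfZ _ _ (rep_fun_linear _)).
- move=> V V' f; apply: rep_ten_ext => v k /=.
  by rewrite (rep_ten_homE f (rep_id rep_unit)) !tens_unitrE (linearfZ _ _ (rep_fun_linear _)).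
- move=> U V W X; apply: rep_ten_extll => u v w x /=.
  rewrite (@tens_assocE _ (tens U V)) (@tens_assocE _ U V (tens W X)).
  rewrite (rep_ten_homE (rep_assoc U V W) (rep_id X)) /= tens_assocE.
  rewrite (@tens_assocE _ U (tens V W)).
  by rewrite (rep_ten_homE (rep_id U) (rep_assoc V W X)) /= tens_assocE.
- move=> V W; apply: rep_ten_extl => v k w /=.
  rewrite tens_assocE (rep_ten_homE (rep_id V) (rep_unitl W)).
  rewrite (rep_ten_homE (rep_unitr V) (rep_id W)) /= tens_unitlE tens_unitrE.
  by rewrite (linearfZ _ _ (linear_purel _)) (linearfZ _ _ (linear_purer _)).
Defined.

End Rep.

(* [resK M] is the [A]-module [M] seen as a [K]-vector space through the
   structure map [k |-> k%:A] of the [K]-algebra [A]. *)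
Section Restriction.
Variables (K : fieldType) (A : comAlgType K).

Definition resK (M : lmodType A) : Type := M.

Section Instances.
Variable M : lmodType A.
HB.instance Definition _ := GRing.Zmodule.on (resK M).

Definition resK_scale (k : K) (m : resK M) : resK M := (k%:A : A) *: (m : M).

Lemma resK_scaleA a b m : resK_scale a (resK_scale b m) = resK_scale (a * b) m.
Proof. by rewrite /resK_scale scalerA -scalerAl mul1r scalerA. Qed.
Lemma resK_scale1 : left_id 1 resK_scale.
Proof. by move=> m; rewrite /resK_scale scale1r [LHS]scale1r. Qed.
Lemma resK_scaleDr : right_distributive resK_scale +%R.
Proof. by move=> k m n; exact: (scalerDr (k%:A : A) (m : M) n). Qed.
Lemma resK_scaleDl m : {morph resK_scale^~ m : a b / a + b}.
Proof. by move=> a b; rewrite /resK_scale scalerDl [LHS]scalerDl. Qed.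

HB.instance Definition _ := GRing.Zmodule_isLmodule.Build K (resK M)
  resK_scaleA resK_scale1 resK_scaleDr resK_scaleDl.
End Instances.

(* The [K]-space [V ⊗ M] with the [A]-module structure
   [a (v ⊗ m) = v ⊗ (a m)]. *)
Definition tensA (V : lmodType K) (M : lmodType A) : Type := tens V (resK M).

Section TensA.
Variables (V : lmodType K) (M : lmodType A).
HB.instance Definition _ := GRing.Zmodule.on (tensA V M).

Definition tensA_scale (a : A) (t : tensA V M) : tensA V M :=
  tens_map id (fun m : resK M => (a *: (m : M)) : resK M) t.

Lemma resK_amul_linear (a : A) :
  linear (fun m : resK M => (a *: (m : M)) : resK M).
Proof.
move=> k m n; rewrite [LHS]scalerDr scalerA mulrC -scalerA.
by [].
Qed.

Lemma tensA_scaleE a v (m : M) :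
  tensA_scale a (v ⊗ (m : resK M)) = v ⊗ ((a *: m : M) : resK M).
Proof. by rewrite /tensA_scale tens_mapE //; exact: resK_amul_linear. Qed.

Lemma tensA_scale_linear a :
  linear (tensA_scale a : tens V (resK M) -> tens V (resK M)).
Proof. by apply: tens_map_linear => //; exact: resK_amul_linear. Qed.

Let L := tensA_scale_linear.

Lemma tensA_scaleA a b t : tensA_scale a (tensA_scale b t) = tensA_scale (a * b) t.
Proof.
move: t; apply: (tens_ext (linear_comp (L a) (L b)) (L (a * b))) => v m.
by rewrite !tensA_scaleE scalerA.
Qed.
Lemma tensA_scale1 : left_id 1 tensA_scale.
Proof.
apply: (tens_ext (L 1) (@linear_id K _)) => v m.
by rewrite tensA_scaleE scale1r.
Qed.
Lemma tensA_scaleDr : right_distributive tensA_scale +%R.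
Proof. by move=> a s t; exact: linearfD (L a). Qed.
Lemma tensA_scaleDl t : {morph tensA_scale^~ t : a b / a + b}.
Proof.
move=> a b; move: t.
apply: (tens_ext (L (a + b)) (linear_add (L a) (L b))) => v m.
by rewrite !tensA_scaleE scalerDl; exact: linearfD (linear_purer v).
Qed.

HB.instance Definition _ := GRing.Zmodule_isLmodule.Build A (tensA V M)
  tensA_scaleA tensA_scale1 tensA_scaleDr tensA_scaleDl.
End TensA.

End Restriction.

Lemma resK_tensA_scaleE (K : fieldType) (A : comAlgType K) (V : lmodType K)
    (M : lmodType A) (k : K) (t : tens V (resK M)) :
  k *: (t : resK (tensA V M)) = k *: t.
Proof.
move: t; apply: (tens_ext (@tensA_scale_linear _ _ V M k%:A)) => [c s t|v m].
  by rewrite scalerDr !scalerA mulrC.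
rewrite [LHS]tensA_scaleE; exact: (linearfZ k (m : resK M) (linear_purer v)).
Qed.

Definition is_derivation (K : fieldType) (A : comAlgType K) (d : A -> A) :
  Prop := linear d /\ forall a b, d (a * b) = d a * b + a * d b.

(* The [K]-linearity of the Lie algebra morphism [anchor] follows from its
   [A]-linearity. *)
Record is_lie_rinehart (K : fieldType) (A : comAlgType K) (L : lmodType A)
    (br : L -> L -> L) (anchor : L -> A -> A) : Prop := IsLieRinehart {
  lr_lie : is_lie_bracket (br : resK L -> resK L -> resK L);
  lr_der : forall x, is_derivation (anchor x);
  lr_anchor_br : forall x y b,
    anchor (br x y) b = anchor x (anchor y b) - anchor y (anchor x b);
  lr_anchor_linear : forall a x y b,
    anchor (a *: x + y) b = a * anchor x b + anchor y b;
  lr_leibniz : forall x a y,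
    br x (a *: y) = a *: br x y + anchor x a *: y }.

Record lieRinehart (K : fieldType) (A : comAlgType K) := LieRinehart {
  lr_mod :> lmodType A;
  lr_br : lr_mod -> lr_mod -> lr_mod;
  anchor : lr_mod -> A -> A;
  lrP : is_lie_rinehart lr_br anchor }.

Section WeakRep.
Variables (K : fieldType) (A : comAlgType K) (L : lieRinehart A).

(* [rho] is [K]-bilinear, that is, a [K]-linear map from [L] to the
   [K]-linear endomorphisms of [M]. *)
Record is_wrep (M : lmodType A) (rho : L -> M -> M) : Prop := IsWRep {
  wrep_bilinear : is_bilinear (rho : resK L -> resK M -> resK M);
  wrep_br : forall x y m, rho (lr_br x y) m = rho x (rho y m) - rho y (rho x m);
  wrep_leibniz : forall x a m,
    rho x (a *: m) = a *: rho x m + anchor x a *: m }.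

Record wrep := WRep {
  wrep_mod :> lmodType A;
  wrep_act : L -> wrep_mod -> wrep_mod;
  wrep_actP : is_wrep wrep_act }.

Definition is_wrep_hom (M N : wrep) (f : M -> N) : Prop :=
  linear f /\ forall x m, f (wrep_act x m) = wrep_act x (f m).

Record wrep_hom (M N : wrep) := WRepHom {
  wrep_fun :> M -> N;
  wrep_funP : is_wrep_hom wrep_fun }.

Lemma wrep_hom_ext (M N : wrep) (f h : wrep_hom M N) : f =1 h -> f = h.
Proof.
case: f h => [f fP] [h hP] /= /funext e; case: _ / e hP => hP.
by congr WRepHom; exact: Prop_irrelevance.
Qed.

Lemma wrep_id_subproof (M : wrep) : is_wrep_hom (@id M).
Proof. by []. Qed.
Definition wrep_id M := WRepHom (wrep_id_subproof M).

Lemma wrep_comp_subproof (M N P : wrep) (f : wrep_hom N P) (h : wrep_hom M N) :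
  is_wrep_hom (f \o h).
Proof.
case: f h => [f [fl fx]] [h [hl hx]]; split=> [k x y|x v] /=.
  by rewrite hl fl.
by rewrite hx fx.
Qed.
Definition wrep_comp M N P f h := WRepHom (@wrep_comp_subproof M N P f h).

Definition WRep_cat : category.
Proof.
apply: (@Category wrep wrep_hom wrep_id wrep_comp).
- by move=> V W f; apply: wrep_hom_ext.
- by move=> V W f; apply: wrep_hom_ext.
- by move=> U V W T f h k; apply: wrep_hom_ext.
Defined.

End WeakRep.

Section CrossedHom.
Variables (K : fieldType) (A : comAlgType K) (L : lieRinehart A).
Variable g : lieAlgebra K.

Definition gA_br (u v : tens g A) : tens g A :=
  tens_lift (fun (x : g) (a : A) =>
    tens_lift (fun (y : g) (b : A) => lie_br x y ⊗ (a * b)) v) u.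

Definition gA_act (x : L) : tens g A -> tens g A := tens_map id (anchor x).

Definition is_crossed_hom (H : L -> tens g A) : Prop :=
  linear (H : resK L -> tens g A) /\
  forall x y, H (lr_br x y) =
    gA_act x (H y) - gA_act y (H x) + gA_br (H x) (H y).

(* The underlying vector space of the semidirect product is [L * tens g A]. *)
Definition iota_H (H : L -> tens g A) (x : L) : L * tens g A := (x, H x).

(* See [boxplusE] for the values on elementary tensors. *)
Definition boxplus (V : rep g) (M : wrep L) (p : L * tens g A)
    (t : tensA V M) : tensA V M :=
  tens_map id (wrep_act p.1 : resK M -> resK M) t +
  tens_lift (fun (y : g) (a : A) =>
    tens_map (rep_act y) (fun m : resK M => (a *: (m : M)) : resK M) t) p.2.

Definition FH_act (H : L -> tens g A) (V : rep g) (M : wrep L) (x : L) :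
  tensA V M -> tensA V M := boxplus (iota_H H x).

Definition FH_map (V V' : rep g) (M M' : wrep L)
    (psi : rep_hom V V') (phi : wrep_hom M M') : tensA V M -> tensA V' M' :=
  tens_map psi (phi : resK M -> resK M').

Definition FH_assoc (V1 V2 : rep g) (M : wrep L) :
  tensA (rep_ten V1 V2) M -> tensA V1 (tensA V2 M) :=
  tens_lift (fun (t : tens V1 V2) (m : resK M) =>
    tens_lift (fun (v1 : V1) (v2 : V2) =>
      v1 ⊗ ((v2 ⊗ m : tensA V2 M) : resK (tensA V2 M))) t).

Definition FH_unit (M : wrep L) : tensA (rep_unit g) M -> M :=
  tens_lift (fun (k : K^o) (m : resK M) => (k : K) *: m).

Lemma gA_brE (x y : g) (a b : A) :
  gA_br (x ⊗ a) (y ⊗ b) = lie_br x y ⊗ (a * b).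
Proof.
have [[brl brr] _ _] := lie_brP g.
have b1 x' (a' : A) : is_bilinear (fun (z : g) (c : A) => lie_br x' z ⊗ (a' * c)).
  split=> [c|z] k u v; first by rewrite brr linear_purel.
  by rewrite mulrDr -scalerAr linear_purer.
rewrite /gA_br tens_liftE ?tens_liftE //.
split=> [a'|x'] k u v; rewrite -tens_lift_linr; congr tens_lift;
  apply/funext => z; apply/funext => c.
  by rewrite brl linear_purel.
by rewrite mulrDl -scalerAl linear_purer.
Qed.

Lemma gA_actE (x : L) (y : g) (a : A) : gA_act x (y ⊗ a) = y ⊗ anchor x a.
Proof.
by rewrite /gA_act tens_mapE //; case: (lrP L) => _ d _ _ _; case: (d x).
Qed.

Lemma wrep_act_linear (M : wrep L) x :
  linear (wrep_act x : resK M -> resK M).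
Proof. by case: (wrep_actP M) => [[_ h]] _ _; exact: h. Qed.

Lemma boxplusE (V : rep g) (M : wrep L) (x : L) (y : g) (a : A) (v : V) (m : M) :
  boxplus (x, y ⊗ a) (v ⊗ (m : resK M)) =
  v ⊗ (wrep_act x m : resK M) + rep_act y v ⊗ ((a *: m : M) : resK M).
Proof.
rewrite /boxplus /= tens_mapE //; last exact: wrep_act_linear.
have mapE y' (a' : A) := tens_mapE (@rep_act_linear _ _ V y')
  (@resK_amul_linear _ _ M a').
have mapL y' (a' : A) := tens_map_linear (@rep_act_linear _ _ V y')
  (@resK_amul_linear _ _ M a').
rewrite tens_liftE ?mapE //; split=> [a'|y'] k u w.
  apply: (tens_ext (mapL _ _) (linear_addscale _ (mapL _ _) (mapL _ _))).
  by move=> v' m'; rewrite !mapE rep_act_linearl linear_purel.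
apply: (tens_ext (mapL _ _) (linear_addscale _ (mapL _ _) (mapL _ _))).
move=> v' m'; rewrite !mapE -linear_purer; congr (_ ⊗ _).
rewrite [LHS]scalerDl; congr (_ + _).
rewrite [RHS](_ : _ = k%:A *: (u *: (m' : M))) //.
by rewrite scalerA -scalerAl mul1r.
Qed.

Lemma FH_mapE (V V' : rep g) (M M' : wrep L)
    (psi : rep_hom V V') (phi : wrep_hom M M') (v : V) (m : M) :
  FH_map psi phi (v ⊗ (m : resK M)) = psi v ⊗ (phi m : resK M').
Proof.
rewrite /FH_map tens_mapE //; first exact: rep_fun_linear.
by move=> k x y; exact: (proj1 (wrep_funP phi) k%:A x y).
Qed.

Lemma FH_assocE (V1 V2 : rep g) (M : wrep L) (v1 : V1) (v2 : V2) (m : M) :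
  @FH_assoc V1 V2 M (v1 ⊗ v2 ⊗ (m : resK M)) =
  v1 ⊗ ((v2 ⊗ (m : resK M) : tensA V2 M) : resK (tensA V2 M)).
Proof.
have b1 (n : resK M) : is_bilinear (fun (w1 : V1) (w2 : V2) =>
    w1 ⊗ ((w2 ⊗ n : tensA V2 M) : resK (tensA V2 M))).
  split=> [w2|w1] k u w; first by rewrite linear_purel.
  by rewrite -linear_purer resK_tensA_scaleE linear_purel.
rewrite /FH_assoc tens_liftE ?tens_liftE //.
split=> [n|t k n n']; first exact: tens_lift_linear (b1 n).
rewrite -tens_lift_linr; congr tens_lift.
apply/funext => w1; apply/funext => w2.
by rewrite -linear_purer resK_tensA_scaleE linear_purer.
Qed.

Lemma FH_unitE (M : wrep L) (k : K) (m : M) :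
  @FH_unit M ((k : K^o) ⊗ (m : resK M)) = k%:A *: m.
Proof. exact: (@tens_unitlE K (resK M) k m). Qed.

End CrossedHom.

Arguments FH_act {K A L g} H V M x t.
Arguments FH_assoc {K A L g} V1 V2 M.
Arguments FH_unit {K A L} g M.
Arguments is_wrep_hom {K A L} M N f.

(* Main.v *)
(* The action of x on V ⊗ M is the sum of its action on M and of the action of
   H x, where the Lie A-algebra g ⊗ A acts on V ⊗ M by
   (y ⊗ a) (v ⊗ m) = y v ⊗ a m.  Both summands are Lie actions, and by the Leibniz
   rule of M the commutator of the operators of x and u is the operator of
   α(x) u, so that the crossed homomorphism equation for H is exactly what makes
   the sum a Lie action.  All other identities hold on elementary tensors. *)
Require Import Defs.
From mathcomp Require Import all_boot all_algebra.
From mathcomp Require Import boolp.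
Set Implicit Arguments.
Unset Strict Implicit.
Unset Printing Implicit Defensive.
Import GRing.Theory.
Local Open Scope ring_scope.

(** * Maps out of [V ⊗ M]: from [A]-linearity to [K]-linearity and back *)

Section ScalarRestriction.
Variables (K : fieldType) (A : comAlgType K).

Lemma resK_linear (M N : lmodType A) (f : M -> N) :
  linear f -> linear (f : resK M -> resK N).
Proof. by move=> fl k x y; exact: (fl k%:A x y). Qed.

Variables (V : lmodType K) (M N : lmodType A).

(** The scalars of [K] reach [V ⊗ M] in two ways, through [k%:A] and through the tensor product. The
    two actions agree only up to a proved equation, [resK_tensA_scaleE], which is rewritten here. *)
Lemma tensA_resK_linear (f : tensA V M -> N) :
  linear f -> linear (f : tens V (resK M) -> resK N).
Proof. by move=> fl k s t; rewrite -(fl k%:A s t) -resK_tensA_scaleE. Qed.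

(** Once [f] is [K]-linear, both sides of the compatibility with [a] are [K]-linear in the tensor,
    so elementary tensors suffice. *)
Lemma tensA_linear (f : tensA V M -> N) :
    linear (f : tens V (resK M) -> resK N) ->
    (forall a v m, f (v ⊗ ((a *: m : M) : resK M)) =
                   a *: f (v ⊗ (m : resK M))) ->
  linear f.
Proof.
move=> fl fA a s t; rewrite [LHS](linearfD _ _ fl); congr (_ + _); move: s.
apply: (tens_ext (linear_comp fl (tensA_scale_linear a))
  (linear_comp (@resK_amul_linear _ _ N a) fl)) => v m.
by rewrite tensA_scaleE fA.
Qed.

Lemma tensA_ext (f h : tensA V M -> N) : linear f -> linear h ->
  (forall v m, f (v ⊗ (m : resK M)) = h (v ⊗ (m : resK M))) -> f =1 h.
Proof.
move=> fl hl.
exact: (tens_ext (tensA_resK_linear fl) (tensA_resK_linear hl)).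
Qed.

End ScalarRestriction.

(** * Iterated tensor products under restriction of scalars *)

Section IteratedTensor.
Variables (K : fieldType) (A : comAlgType K).
Variables (V W : lmodType K) (M N : lmodType A).

Lemma linear_purer_tensA (w : W) : linear (fun t : tens V (resK M) =>
  w ⊗ ((t : tensA V M) : resK (tensA V M))).
Proof. by move=> k s t; rewrite -linear_purer resK_tensA_scaleE. Qed.

Lemma tensA_extl (f h : tensA (tens V W) M -> N) :
    linear f -> linear h ->
    (forall v w m, f (v ⊗ w ⊗ (m : resK M)) = h (v ⊗ w ⊗ (m : resK M))) ->
  f =1 h.
Proof.
move=> fl hl.
exact: (tens_extl (tensA_resK_linear fl) (tensA_resK_linear hl)).
Qed.

End IteratedTensor.

(** * The two summands of the action on [V ⊗ M] *)

Section TensAct.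
Variables (K : fieldType) (A : comAlgType K) (L : lieRinehart A).
Variable g : lieAlgebra K.

Definition wact (V : lmodType K) (M : wrep L) (x : L) :
    tens V (resK M) -> tens V (resK M) :=
  tens_map id (wrep_act x : resK M -> resK M).

Definition gA_rep (V : rep g) (M : lmodType A) (u : tens g A)
    (t : tens V (resK M)) : tens V (resK M) :=
  tens_lift (fun (y : g) (a : A) =>
    tens_map (rep_act y) (fun m : resK M => (a *: (m : M)) : resK M) t) u.

(** Holds by conversion; it separates the summand through [M] from the summand through [g ⊗ A],
    which are then studied one at a time. *)
Lemma FH_actE (H : L -> tens g A) (V : rep g) (M : wrep L) x t :
  FH_act H V M x t = wact x t + gA_rep (H x) t.
Proof. by []. Qed.

(** * The summand through [M] *)

Section Wact.
Variables (V : lmodType K) (M : wrep L).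

Lemma wactE x (v : V) (m : M) :
  wact x (v ⊗ (m : resK M)) = v ⊗ (wrep_act x m : resK M).
Proof. by rewrite /wact tens_mapE //; exact: wrep_act_linear. Qed.

Lemma wact_linear x : linear (@wact V M x).
Proof. by apply: tens_map_linear => //; exact: wrep_act_linear. Qed.

Lemma wact_linearl t : linear ((fun x => @wact V M x t) : resK L -> _).
Proof.
move=> k x y; move: t.
apply: (tens_ext (wact_linear _)
  (linear_addscale _ (wact_linear _) (wact_linear _))) => v m.
rewrite !wactE -linear_purer; congr (_ ⊗ _).
by case: (wrep_actP M) => [[actl _] _ _]; exact: (actl m k x y).
Qed.

Lemma wact_br x y (t : tens V (resK M)) :
  wact (lr_br x y) t = wact x (wact y t) - wact y (wact x t).
Proof.
move: t; apply: tens_ext; first exact: wact_linear.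
  by apply: linear_sub; apply: linear_comp; exact: wact_linear.
move=> v m; rewrite !wactE -(linearfB _ _ (linear_purer _)).
by case: (wrep_actP M) => _ -> _.
Qed.

(** [A] acts on [V ⊗ M] through the factor [M] alone, so the Leibniz rule of [M] carries over. *)
Lemma wact_leibniz x a (t : tensA V M) :
  wact x (a *: t) = a *: (wact x t : tensA V M) + anchor x a *: t.
Proof.
have Z := @tensA_scale_linear K A V M.
move: t; apply: (tens_ext (linear_comp (wact_linear x) (Z a))
  (linear_add (linear_comp (Z a) (wact_linear x)) (Z (anchor x a)))) => v m.
rewrite wactE !tensA_scaleE wactE.
case: (wrep_actP M) => _ _ ->; exact: linearfD (linear_purer v).
Qed.

End Wact.

(** * The bracket of [g ⊗ A] and its action on [V ⊗ M] *)

Lemma gA_br_linearr (u : tens g A) : linear (gA_br u).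
Proof.
have [[_ brr] _ _] := lie_brP g.
(* The second argument sits inside the outer lift; [tens_lift_linr] carries the linear combination
   there, where linearity of the inner lift applies. *)
move=> k v w; rewrite -tens_lift_linr; congr tens_lift.
apply/funext => x; apply/funext => a; apply: tens_lift_linear.
split=> [b|z] c p q; first by rewrite brr linear_purel.
by rewrite mulrDr -scalerAr linear_purer.
Qed.

Lemma gA_br_linearl (v : tens g A) : linear (fun u : tens g A => gA_br u v).
Proof.
have [[brl _] _ _] := lie_brP g.
apply: tens_lift_linear; split=> [a'|x'] k u w; rewrite -tens_lift_linr;
  congr tens_lift; apply/funext => z; apply/funext => c.
  by rewrite brl linear_purel.
by rewrite mulrDl -scalerAl linear_purer.
Qed.

Section GARep.
Variables (V : rep g) (M : lmodType A).

Let mapL y a := tens_map_linear (@rep_act_linear _ _ V y)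
  (@resK_amul_linear _ _ M a).

(** This makes the [tens_lift] in [gA_rep] meaningful for each fixed [t]. *)
Let gA_rep_bilinear (t : tens V (resK M)) : is_bilinear (fun (y : g) (a : A) =>
  tens_map (rep_act y) (fun m : resK M => (a *: (m : M)) : resK M) t).
Proof.
have mapE y (a : A) := tens_mapE (@rep_act_linear _ _ V y)
  (@resK_amul_linear _ _ M a).
split=> [a|y] k u w; move: t;
  apply: (tens_ext (mapL _ _) (linear_addscale _ (mapL _ _) (mapL _ _))) => v m.
  by rewrite !mapE rep_act_linearl linear_purel.
rewrite !mapE -linear_purer; congr (_ ⊗ _).
rewrite [LHS]scalerDl; congr (_ + _).
(* On [resK M] the scalar [k] acts as [k%:A] by definition; this exposes two successive
   [A]-scalings. *)
rewrite [RHS](_ : _ = k%:A *: (u *: (m : M))) //.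
by rewrite scalerA -scalerAl mul1r.
Qed.

Lemma gA_repE y a v (m : M) :
  gA_rep (y ⊗ a) (v ⊗ (m : resK M)) =
  (rep_act y v : V) ⊗ ((a *: m : M) : resK M).
Proof.
rewrite /gA_rep (tens_liftE (gA_rep_bilinear _)) tens_mapE //.
  exact: rep_act_linear.
exact: resK_amul_linear.
Qed.

Lemma gA_rep_linearl t : linear (fun u => @gA_rep V M u t).
Proof. exact: tens_lift_linear (gA_rep_bilinear t). Qed.

Lemma gA_rep_linear u : linear (@gA_rep V M u).
Proof.
move=> k s t; rewrite -tens_lift_linr; congr tens_lift.
by apply/funext => y; apply/funext => a; exact: mapL.
Qed.

(** On elementary tensors this is commutativity of [A]: the coefficient of [u] and the scalar [a]
    both multiply the factor [M]. *)
Lemma gA_rep_scale u a (t : tensA V M) :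
  gA_rep u (a *: t) = a *: (gA_rep u t : tensA V M).
Proof.
have Z := @tensA_scale_linear K A V M a.
move: t; apply: (tens_ext (linear_comp (gA_rep_linear u) Z)
  (linear_comp Z (gA_rep_linear u))) => v m.
rewrite tensA_scaleE; move: u.
apply: (tens_ext (gA_rep_linearl _) (linear_comp Z (gA_rep_linearl _))) => y b.
by rewrite !gA_repE [RHS]tensA_scaleE !scalerA mulrC.
Qed.

(** With all three arguments elementary, commutativity of [A] gives both compositions the same
    coefficient [a * b], and the commutator formula for the representation [V] remains. *)
Lemma gA_rep_br u v (t : tens V (resK M)) :
  gA_rep (gA_br u v) t = gA_rep u (gA_rep v t) - gA_rep v (gA_rep u t).
Proof.
have Ll := gA_rep_linearl; have Lr := gA_rep_linear.
move: u; apply: (tens_ext (linear_comp (Ll t) (gA_br_linearl v))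
  (linear_sub (Ll _) (linear_comp (Lr v) (Ll t)))) => x a.
move: v; apply: (tens_ext (linear_comp (Ll t) (gA_br_linearr _))
  (linear_sub (linear_comp (Lr _) (Ll t)) (Ll _))) => y b.
move: t; apply: (tens_ext (Lr _)
  (linear_sub (linear_comp (Lr _) (Lr _)) (linear_comp (Lr _) (Lr _)))) => v m.
rewrite gA_brE !gA_repE !scalerA [b * a]mulrC rep_act_br.
exact: linearfB (linear_purel _).
Qed.

End GARep.

(** * Interaction of the two summands *)

Lemma gA_act_linear (x : L) : linear (@gA_act K A L g x).
Proof.
by apply: tens_map_linear => //; case: (lrP L) => _ d _ _ _; case: (d x).
Qed.

(** For [u = y ⊗ a], the Leibniz rule of [M] on [a *: m] yields an extra term with [anchor x a] in
    place of [a], which is the operator of [gA_act x u]. *)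
Lemma wact_gA_rep (V : rep g) (M : wrep L) x u (t : tens V (resK M)) :
  wact x (gA_rep u t) = gA_rep u (wact x t) + gA_rep (gA_act x u) t.
Proof.
have Ll := gA_rep_linearl; have Lr := gA_rep_linear.
have W := @wact_linear V M x.
move: u; apply: (tens_ext (linear_comp W (Ll _ _ t))
  (linear_add (Ll _ _ _) (linear_comp (Ll _ _ t) (@gA_act_linear x)))) => y a.
move: t; apply: (tens_ext (linear_comp W (Lr _ _ _))
  (linear_add (linear_comp (Lr _ _ _) W) (Lr _ _ _))) => v m.
rewrite gA_actE !gA_repE !wactE gA_repE.
case: (wrep_actP M) => _ _ ->; exact: linearfD (linear_purer _).
Qed.

(** * The weak representation on [V ⊗ M] given by a crossed homomorphism *)

Variable H : L -> tens g A.
Hypothesis crossedH : is_crossed_hom H.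

Lemma FH_act_linear (V : rep g) (M : wrep L) x :
  linear (FH_act H V M x : tens V (resK M) -> tens V (resK M)).
Proof. exact: (linear_add (wact_linear x) (gA_rep_linear (H x))). Qed.

Lemma FH_act_wrep (V : rep g) (M : wrep L) : is_wrep (FH_act H V M).
Proof.
have [Hl Hbr] := crossedH; split.
- split=> [t k x y|x k s t]; last by rewrite !resK_tensA_scaleE FH_act_linear.
  rewrite resK_tensA_scaleE !FH_actE Hl gA_rep_linearl.
  by rewrite (wact_linearl t k x y) scalerDr addrACA.
- move=> x y t; rewrite !FH_actE Hbr.
  have Ll := gA_rep_linearl.
  rewrite (linearfD _ _ (Ll _ _ t)) (linearfB _ _ (Ll _ _ t)).
  rewrite !(linearfD _ _ (wact_linear _)) !(linearfD _ _ (gA_rep_linear _)).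
  rewrite wact_br gA_rep_br !wact_gA_rep.
  set a := wact x _; set b := wact y _; set c := gA_rep _ (wact x t).
  set d := gA_rep _ (wact y t); set p := gA_rep (gA_act x _) t.
  set q := gA_rep (gA_act y _) t; set r := gA_rep _ _; set s := gA_rep _ _.
  (* The mixed terms [c] and [d] occur in both compositions and are grouped so that [addrKA] cancels
     them. The terms [p] and [q] are those that the crossed homomorphism equation contributes on the
     left. *)
  rewrite [X in _ = X - _](AC (1*2*2) (1*3*5*(2*4))).
  rewrite [X in _ = _ - X](AC (1*2*2) ((4*2)*(1*3*5))).
  by rewrite addrKA !opprD [RHS](AC (3*3) (1*4*(2*5*(3*6)))).
- move=> x a t; rewrite !FH_actE wact_leibniz gA_rep_scale scalerDr.
  by rewrite addrAC.
Qed.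

Definition FH (V : rep g) (M : wrep L) : wrep L := WRep (FH_act_wrep V M).

(** * The action on morphisms *)

Section Morphisms.
Variables (V V' : rep g) (M M' : wrep L).
Variables (psi : rep_hom V V') (phi : wrep_hom M M').

Lemma wrep_fun_linear : linear phi.
Proof. by case: (wrep_funP phi). Qed.

Let FH_map_Klinear : linear (FH_map psi phi :
  tens V (resK M) -> tens V' (resK M')).
Proof.
apply: tens_map_linear; first exact: rep_fun_linear.
exact: resK_linear wrep_fun_linear.
Qed.

Lemma FH_map_linear : linear (FH_map psi phi).
Proof.
apply: tensA_linear => [k s t|a v m].
  by rewrite FH_map_Klinear resK_tensA_scaleE.
by rewrite !FH_mapE [RHS]tensA_scaleE (GRing.scalable_linear wrep_fun_linear).
Qed.

Lemma FH_map_wact x t : FH_map psi phi (wact x t) = wact x (FH_map psi phi t).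
Proof.
move: t; apply: (tens_ext (linear_comp FH_map_Klinear (wact_linear x))
  (linear_comp (wact_linear x) FH_map_Klinear)) => v m.
rewrite wactE !FH_mapE wactE.
by case: (wrep_funP phi) => _ ->.
Qed.

(** On elementary tensors, equivariance of [psi] handles the factor [V] and [A]-linearity of [phi]
    handles the factor [M]. *)
Lemma FH_map_gA_rep u t :
  FH_map psi phi (gA_rep u t) = gA_rep u (FH_map psi phi t).
Proof.
move: t; apply: (tens_ext (linear_comp FH_map_Klinear (gA_rep_linear u))
  (linear_comp (gA_rep_linear u) FH_map_Klinear)) => v m.
rewrite FH_mapE; move: u.
apply: (tens_ext (linear_comp FH_map_Klinear (gA_rep_linearl _))
  (gA_rep_linearl _)) => y a.
by rewrite !gA_repE FH_mapE rep_fun_act (GRing.scalable_linear wrep_fun_linear).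
Qed.

Lemma FH_map_hom : is_wrep_hom (FH V M) (FH V' M') (FH_map psi phi).
Proof.
split=> [|x t]; first exact: FH_map_linear.
rewrite [wrep_act x t]FH_actE (linearfD _ _ FH_map_Klinear) FH_map_wact.
by rewrite FH_map_gA_rep.
Qed.

End Morphisms.

(** * The associativity isomorphism *)

Section Associator.
Variables (V1 V2 : rep g) (M : wrep L).

Let FH_assoc_bilinear : is_bilinear (fun (t : tens V1 V2) (m : resK M) =>
    tens_lift (fun (v1 : V1) (v2 : V2) =>
      v1 ⊗ ((v2 ⊗ m : tensA V2 M) : resK (tensA V2 M))) t).
Proof.
have b1 (n : resK M) : is_bilinear (fun (w1 : V1) (w2 : V2) =>
    w1 ⊗ ((w2 ⊗ n : tensA V2 M) : resK (tensA V2 M))).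
  split=> [w2|w1] k u w; first by rewrite linear_purel.
  by rewrite -linear_purer resK_tensA_scaleE linear_purel.
split=> [n|t k n n']; first exact: tens_lift_linear (b1 n).
rewrite -tens_lift_linr; congr tens_lift.
apply/funext => w1; apply/funext => w2.
by rewrite -linear_purer resK_tensA_scaleE linear_purer.
Qed.

Let FH_assoc_Klinear : linear (FH_assoc V1 V2 M :
  tens (tens V1 V2) (resK M) -> tens V1 (resK (tensA V2 M))).
Proof. exact: tens_lift_linear FH_assoc_bilinear. Qed.

Lemma FH_assoc_linear : linear (FH_assoc V1 V2 M).
Proof.
have Z := @tensA_scale_linear K A.
apply: tensA_linear => [k s t|a t m].
  by rewrite FH_assoc_Klinear resK_tensA_scaleE.
move: t; apply: (tens_ext (linear_comp FH_assoc_Klinear (linear_purel _))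
  (linear_comp (Z _ _ a) (linear_comp FH_assoc_Klinear (linear_purel _)))).
move=> v1 v2; rewrite !FH_assocE tensA_scaleE; congr (_ ⊗ _).
by rewrite [RHS]tensA_scaleE.
Qed.

(** An element of [g] acts on [V1 ⊗ V2] as a sum over the two factors, one summand for each term on
    the right. Here [u] is arbitrary because [H x] need not be an elementary tensor. *)
Lemma FH_assoc_gA_rep u (v1 : V1) (v2 : V2) (m : M) :
  FH_assoc V1 V2 M (@gA_rep (rep_ten V1 V2) M u (v1 ⊗ v2 ⊗ (m : resK M))) =
  v1 ⊗ ((gA_rep u (v2 ⊗ (m : resK M)) : tensA V2 M) : resK (tensA V2 M)) +
  @gA_rep V1 (tensA V2 M) u
    (v1 ⊗ ((v2 ⊗ (m : resK M) : tensA V2 M) : resK (tensA V2 M))).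
Proof.
have Ll := gA_rep_linearl.
have pl := @linear_purer_tensA K A V2 V1 M v1.
move: u; apply: (tens_ext
  (linear_comp FH_assoc_Klinear (@Ll (rep_ten V1 V2) M _))
  (linear_add (linear_comp pl (Ll _ _ _)) (@Ll V1 (tensA V2 M) _))) => y a.
rewrite !gA_repE [rep_act y _]rep_ten_actE.
rewrite (linearfD _ _ (linear_purel _)) (linearfD _ _ FH_assoc_Klinear).
rewrite !FH_assocE addrC; congr (_ + _ ⊗ _).
by rewrite [RHS]tensA_scaleE.
Qed.

Lemma FH_assoc_hom :
  is_wrep_hom (FH (rep_ten V1 V2) M) (FH V1 (FH V2 M)) (FH_assoc V1 V2 M).
Proof.
split=> [|x]; first exact: FH_assoc_linear.
apply: (tens_extl
  (linear_comp FH_assoc_Klinear (@FH_act_linear (rep_ten V1 V2) M x))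
  (linear_comp (@FH_act_linear V1 (FH V2 M) x) FH_assoc_Klinear)) => v1 v2 m.
rewrite !FH_actE (linearfD _ _ FH_assoc_Klinear) FH_assoc_gA_rep.
rewrite wactE !FH_assocE (@wactE V1 (FH V2 M)) addrA; congr (_ + _).
(* The action through [M] and the part of [H x] acting on [V2] combine into the action of [x] on
   [FH V2 M]. *)
rewrite -(linearfD _ _ (linear_purer _)); congr (_ ⊗ _).
by rewrite [RHS]FH_actE wactE.
Qed.

Definition FH_assocV : tensA V1 (tensA V2 M) -> tensA (rep_ten V1 V2) M :=
  tens_lift (fun (v1 : V1) (t : resK (tensA V2 M)) =>
    tens_lift (fun (v2 : V2) (m : resK M) => v1 ⊗ v2 ⊗ m) t).

Let bil1 (v1 : V1) :
  is_bilinear (fun (v2 : V2) (m : resK M) => v1 ⊗ v2 ⊗ m).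
Proof.
split=> [m|v2] k x y; last exact: linear_purer.
by rewrite linear_purer linear_purel.
Qed.

Let bil2 : is_bilinear (fun (v1 : V1) (t : resK (tensA V2 M)) =>
  tens_lift (fun (v2 : V2) (m : resK M) => v1 ⊗ v2 ⊗ m) t).
Proof.
split=> [t k u u'|u k s t].
  rewrite -tens_lift_linr; congr tens_lift.
  by apply/funext => v; apply/funext => w; rewrite !linear_purel.
by rewrite resK_tensA_scaleE (tens_lift_linear (bil1 u)).
Qed.

Lemma FH_assocVE (v1 : V1) (v2 : V2) (m : M) :
  FH_assocV (v1 ⊗ ((v2 ⊗ (m : resK M) : tensA V2 M) : resK (tensA V2 M))) =
  v1 ⊗ v2 ⊗ (m : resK M).
Proof. by rewrite /FH_assocV (tens_liftE bil2) (tens_liftE (bil1 v1)). Qed.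

Let FH_assocV_Klinear : linear (FH_assocV :
  tens V1 (resK (tensA V2 M)) -> tens (tens V1 V2) (resK M)).
Proof. exact: tens_lift_linear bil2. Qed.

Lemma FH_assocK : cancel (FH_assoc V1 V2 M) FH_assocV.
Proof.
apply: (tens_extl (linear_comp FH_assocV_Klinear FH_assoc_Klinear)
  (@linear_id _ _)) => v1 v2 m.
by rewrite FH_assocE FH_assocVE.
Qed.

Lemma FH_assocVK : cancel FH_assocV (FH_assoc V1 V2 M).
Proof.
have lin := linear_comp FH_assoc_Klinear FH_assocV_Klinear.
(* The reduction goes one factor at a time, since the inner space carries the scalars of
   [resK (tensA V2 M)] rather than those of [tens V2 (resK M)]. *)
apply: (tens_ext lin (@linear_id _ _)) => v1.
have pl := @linear_purer_tensA K A V2 V1 M v1.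
apply: (tens_ext (linear_comp lin pl) pl) => v2 m.
by rewrite FH_assocVE FH_assocE.
Qed.

End Associator.

(** * The unit isomorphism *)

Section Unit.
Variable M : wrep L.

Let FH_unit_Klinear : linear (FH_unit g M : tens K^o (resK M) -> resK M).
Proof. exact: (@tens_unitl_linear K (resK M)). Qed.

Lemma FH_unit_linear : linear (FH_unit g M).
Proof.
apply: (tensA_linear FH_unit_Klinear) => a k m.
by rewrite !FH_unitE !scalerA mulrC.
Qed.

Lemma FH_unit_hom : is_wrep_hom (FH (rep_unit g) M) M (FH_unit g M).
Proof.
split=> [|x]; first exact: FH_unit_linear.
have ext := (tens_ext
  (linear_comp FH_unit_Klinear (@FH_act_linear (rep_unit g) M x))
  (linear_comp (@wrep_act_linear K A L M x) FH_unit_Klinear)).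
apply: ext => k m.
rewrite FH_actE (linearfD _ _ FH_unit_Klinear) wactE !FH_unitE.
rewrite [RHS](linearfZ (k : K) (m : resK M) (@wrep_act_linear K A L M x)).
(* The Lie algebra [g] acts by zero on the unit object, so the summand through [H] vanishes. *)
suff -> : gA_rep (H x) (k ⊗ (m : resK M)) = 0 :> tensA (rep_unit g) M.
  by rewrite (linearf0 FH_unit_Klinear) addr0.
move: (H x).
apply: (tens_ext (@gA_rep_linearl (rep_unit g) M _)) => [c u v|y a].
  by rewrite scaler0 addr0.
by rewrite gA_repE /= (linearf0 (linear_purel _)).
Qed.

Definition FH_unitV (m : M) : tensA (rep_unit g) M := (1 : K^o) ⊗ (m : resK M).

Lemma FH_unitK : cancel (FH_unit g M) FH_unitV.
Proof.
apply: (tens_ext (linear_comp (linear_purer (1 : K^o)) FH_unit_Klinear)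
  (@linear_id _ _)) => k m.
rewrite FH_unitE.
(* The scalar crosses the tensor sign: [1 ⊗ k m] becomes [k 1 ⊗ m]. *)
rewrite [LHS](linearfZ (k : K) (m : resK M) (linear_purer (1 : K^o))).
by rewrite -(linearfZ _ _ (linear_purel _)) /= [_ *: _]mulr1.
Qed.

Lemma FH_unitVK : cancel FH_unitV (FH_unit g M).
Proof. by move=> m; rewrite FH_unitE !scale1r. Qed.

End Unit.

(** * Equality of morphisms tested on elementary tensors *)

Lemma FH_ext (V : rep g) (M N : wrep L) (f h : wrep_hom (FH V M) N) :
  (forall v m, f (v ⊗ (m : resK M)) = h (v ⊗ (m : resK M))) -> f = h.
Proof.
move=> fh; apply: wrep_hom_ext.
exact: (tensA_ext (wrep_fun_linear f) (wrep_fun_linear h) fh).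
Qed.

Lemma FH_extl (V W : rep g) (M N : wrep L)
    (f h : wrep_hom (FH (rep_ten V W) M) N) :
  (forall (v : V) (w : W) m,
    f (v ⊗ w ⊗ (m : resK M)) = h (v ⊗ w ⊗ (m : resK M))) -> f = h.
Proof.
move=> fh; apply: wrep_hom_ext.
exact: (tensA_extl (wrep_fun_linear f) (wrep_fun_linear h) fh).
Qed.

(** Serves the pentagon, whose source involves three representations. For fixed [m] a [K]-linear map
    on the triple tensor product is left. *)
Lemma FH_extll (V W U : rep g) (M N : wrep L)
    (f h : wrep_hom (FH (rep_ten (rep_ten V W) U) M) N) :
  (forall (v : V) (w : W) (u : U) m,
    f (v ⊗ w ⊗ u ⊗ (m : resK M)) = h (v ⊗ w ⊗ u ⊗ (m : resK M))) -> f = h.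
Proof.
have lin (k : wrep_hom (FH (rep_ten (rep_ten V W) U) M) N) (m : M) :=
  linear_comp (tensA_resK_linear (wrep_fun_linear k))
    (linear_purel (m : resK M)).
move=> fh; apply: FH_ext => t m; move: t.
by apply: (tens_extl (lin f m) (lin h m)) => v w u; exact: fh.
Qed.

End TensAct.

(** A two-sided inverse map of a morphism is itself a morphism, as one sees by applying the
    injective [f]; hence the inverses of the structure maps need only the cancellation
    identities. *)
Lemma wrep_hom_is_iso (K : fieldType) (A : comAlgType K) (L : lieRinehart A)
    (M N : wrep L) (f : M -> N) (h : N -> M) (fP : is_wrep_hom M N f) :
  cancel f h -> cancel h f -> @is_iso (WRep_cat L) M N (WRepHom fP).
Proof.
have [fl fx] := fP; move=> fK hK.
have hP : is_wrep_hom N M h.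
  by split=> [a s t|x t]; apply: (can_inj fK); rewrite ?fl ?fx !hK.
by exists (WRepHom hP); split; apply: wrep_hom_ext.
Qed.

(** * The left module category structure *)

Theorem theorem3p26 (K : closedFieldType) (charK : [pchar K] =i pred0)
    (A : comAlgType K) (L : lieRinehart A) (g : lieAlgebra K)
    (H : L -> tens g A) (crossedH : is_crossed_hom H) :
  exists F0 : forall (V : Rep_mon g) (M : WRep_cat L), is_wrep (FH_act H V M),
  let F (V : Rep_mon g) (M : WRep_cat L) : WRep_cat L := WRep (F0 V M) in
  exists (F1 : forall (V V' : Rep_mon g) (M M' : WRep_cat L)
             (psi : mor V V') (phi : mor M M'),
             is_wrep_hom (F V M) (F V' M') (FH_map psi phi))
         (Fa : forall (V1 V2 : Rep_mon g) (M : WRep_cat L),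
             is_wrep_hom (F (ten V1 V2) M) (F V1 (F V2 M)) (FH_assoc V1 V2 M))
         (Fl : forall M : WRep_cat L,
             is_wrep_hom (F (unit_obj (Rep_mon g)) M) M (FH_unit g M)),
    is_left_module_category (C := Rep_mon g) (M := WRep_cat L) (act := F)
      (fun V V' M M' psi phi => WRepHom (F1 V V' M M' psi phi))
      (fun V1 V2 M => WRepHom (Fa V1 V2 M))
      (fun M => WRepHom (Fl M)).
Proof.
exists (FH_act_wrep crossedH) => F.
exists (@FH_map_hom K A L g H crossedH).
exists (FH_assoc_hom crossedH).
exists (FH_unit_hom crossedH).
split.
- split=> [V M|V V' V'' M M' M'' f' f h' h];
    apply: (FH_ext (crossedH := crossedH)) => v m /=; first by rewrite FH_mapE.
  by rewrite !FH_mapE.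
- by move=> X Y N; apply: wrep_hom_is_iso;
    [exact: FH_assocK|exact: FH_assocVK].
- move=> X X' Y Y' N N' f h k.
  apply: (FH_extl (crossedH := crossedH)) => x y n /=.
  rewrite FH_assocE (FH_mapE (rep_ten_hom f h) k) /= rep_ten_homE FH_assocE.
  (* [FH_mapE] speaks of bundled morphisms, so the nested map is supplied together with its proof of
     being one. *)
  by rewrite (FH_mapE f (WRepHom (FH_map_hom crossedH h k))) /= FH_mapE.
- by move=> N; apply: wrep_hom_is_iso; [exact: FH_unitK|exact: FH_unitVK].
- move=> N N' f; apply: (FH_ext (crossedH := crossedH)) => k n /=.
  by rewrite FH_mapE !FH_unitE (GRing.scalable_linear (wrep_fun_linear f)).
(* Pentagon: both composites send [x ⊗ y ⊗ z ⊗ n] to [x ⊗ (y ⊗ (z ⊗ n))]. *)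
- move=> X Y Z N; apply: (FH_extll (crossedH := crossedH)) => x y z n /=.
  rewrite (FH_mapE (rep_assoc X Y Z) (wrep_id N)) /= tens_assocE.
  rewrite (@FH_assocE _ _ _ _ (rep_ten X Y) Z).
  rewrite (@FH_assocE _ _ _ _ X Y (F Z N)) (@FH_assocE _ _ _ _ X (rep_ten Y Z)).
  rewrite (FH_mapE (rep_id X) (WRepHom (FH_assoc_hom crossedH Y Z N))) /=.
  by rewrite FH_assocE.
- move=> X N; apply: (FH_extl (crossedH := crossedH)) => x k n /=.
  rewrite FH_assocE (FH_mapE (rep_id X) (WRepHom (FH_unit_hom crossedH N))) /=.
  rewrite (FH_mapE (rep_unitr X) (wrep_id N)) /= FH_unitE tens_unitrE.
  (* Triangle: the scalar [k] sits on [x] on one side and on [n] on the other; both equal [k] times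
     [x ⊗ n]. *)
  rewrite (linearfZ _ _ (linear_purel _)).
  exact: (linearfZ (k : K) (n : resK N) (linear_purer x)).
Qed.
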